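(* Let $L$ be a metabelian Lie ring. Then $2\,\delta_n(L)\subseteq\gamma_n(L)$ for all $n\geq 1$.
   Context: A Lie ring is a Lie algebra over the ring $\mathbb{Z}$ of integers (an abelian group with a biadditive bracket satisfying $[x,x]=0$ and the Jacobi identity); no freeness or finite generation is assumed. For additive subgroups $A,B$ of $L$, $[A,B]$ denotes the additive subgroup generated by all $[a,b]$ with $a\in A$, $b\in B$. The derived subring is $L'=[L,L]$, the second derived subring is $L''=[L',L']$, and $L$ is metabelian if $L''=0$. The lower central series of $L$ is defined by $\gamma_1(L)=L$ and $\gamma_{n+1}(L)=[L,\gamma_n(L)]$ for $n\geq 1$. Let $\mathcal{U}(L)$ be the universal enveloping algebra of $L$ over $\mathbb{Z}$, and let $L$ be regarded as embedded in $\mathcal{U}(L)$ via the canonical map (which is injective for Lie rings over $\mathbb{Z}$). The augmentation ideal $\varpi(L)$ is the two-sided ideal of $\mathcal{U}(L)$ generated by $L$, and $\varpi^n(L)$ is its $n$-th power. The Lie dimension series is $\delta_n(L)=L\cap\varpi^n(L)$, $n\geq 1$. For an additive subgroup $A$, $2A=\{2a : a\in A\}$. *)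

(* Defs.v *)
From HB Require Import structures.
From mathcomp Require Import all_boot all_order all_algebra.
From mathcomp Require Import generic_quotient ring_quotient.
From mathcomp Require Import monalg.
From mathcomp Require Import boolp classical_sets.

Set Implicit Arguments.
Unset Strict Implicit.
Unset Printing Implicit Defensive.

Import GRing.Theory.
Local Open Scope quotient_scope.
Local Open Scope classical_set_scope.
Local Open Scope ring_scope.

HB.mixin Record Zmodule_isLieRing L of GRing.Zmodule L := {
  bracket : L -> L -> L;
  bracketDl : forall x y z, bracket (x + y) z = bracket x z + bracket y z;
  bracketDr : forall x y z, bracket x (y + z) = bracket x y + bracket x z;
  bracketxx : forall x, bracket x x = 0;
  jacobi : forall x y z,
    bracket x (bracket y z) + bracket y (bracket z x)
      + bracket z (bracket x y) = 0
}.

#[short(type="lieRingType")]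
HB.structure Definition LieRing := { L of GRing.Zmodule L & Zmodule_isLieRing L }.

Definition additive_subgroup (V : zmodType) (A : set V) : Prop :=
  A 0 /\ forall x y, A x -> A y -> A (x - y).

Definition zspan (V : zmodType) (S : set V) : set V :=
  smallest (@additive_subgroup V) S.

Definition lie_prod (L : lieRingType) (A B : set L) : set L :=
  zspan [set z | exists a b, [/\ A a, B b & z = bracket a b]].

Definition derived (L : lieRingType) : set L := lie_prod [set: L] [set: L].
Arguments derived L : clear implicits.

Definition derived2 (L : lieRingType) : set L :=
  lie_prod (derived L) (derived L).

Arguments derived2 L : clear implicits.

Definition metabelian (L : lieRingType) : Prop := derived2 L = [set 0].

(* The series is indexed from 1; the value [lcs L 0] is a dummy. *)
Fixpoint lcs (L : lieRingType) (n : nat) : set L :=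
  match n with
  | 0 | 1 => [set: L]
  | m.+1 => lie_prod [set: L] (@lcs L m)
  end.
Arguments lcs L n : clear implicits.

Definition two_sided_ideal (R : pzRingType) (I : set R) : Prop :=
  additive_subgroup I /\ forall a x, I x -> I (a * x) /\ I (x * a).

Definition ideal_gen (R : pzRingType) (S : set R) : set R :=
  smallest (@two_sided_ideal R) S.

Definition ideal_prod (R : pzRingType) (I J : set R) : set R :=
  zspan [set z | exists a b, [/\ I a, J b & z = a * b]].

Fixpoint ideal_pow (R : pzRingType) (I : set R) (n : nat) : set R :=
  match n with
  | 0 => [set: R]
  | 1 => I
  | m.+1 => ideal_prod I (@ideal_pow R I m)
  end.

Lemma ideal_gen_ideal (R : pzRingType) (S : set R) :
  two_sided_ideal (ideal_gen S).
Proof.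
split; first split.
- by move=> I [[[I0 _] _] _].
- move=> x y Ix Iy I HI; move: (HI) => [[[_ IB] _] _].
  by apply: IB; [exact: Ix|exact: Iy].
- by move=> a x Ix; split=> I HI; move: (HI) => [[_ IM] _];
    case: (IM a x (Ix I HI)).
Qed.

Lemma ideal_gen_sub (R : pzRingType) (S : set R) : S `<=` ideal_gen S.
Proof. by move=> x Sx I [_]; apply. Qed.

Section Envelope.
Variable L : lieRingType.

(* The free associative unital ring on the underlying set of [L]. *)
Definition free_ring : nzRingType := {malg int[fmonom L]}.

Definition free_gen (x : L) : free_ring := << fmu x >>.

(* U(L) is the tensor ring of the abelian group L modulo
   [x, y] = xy - yx; the tensor ring is itself the free ring on the set L
   modulo additivity of the generators, so both families are imposed here. *)
Definition envelope_rel : set free_ring :=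
  [set r | (exists x y, r = free_gen (x + y) - (free_gen x + free_gen y)) \/
           (exists x y, r = free_gen (bracket x y)
              - (free_gen x * free_gen y - free_gen y * free_gen x))].

Definition envelope_ideal : {pred free_ring} :=
  fun r => `[< ideal_gen envelope_rel r >].

Lemma envelope_ideal_zmod : zmod_closed envelope_ideal.
Proof.
have [[I0 IB] _] := ideal_gen_ideal envelope_rel.
split; first by apply/asboolP.
by move=> x y /asboolP Ix /asboolP Iy; apply/asboolP; exact: IB.
Qed.

HB.instance Definition _ :=
  GRing.isZmodClosed.Build free_ring envelope_ideal envelope_ideal_zmod.

Definition envelope : Type := Quotient.quot envelope_ideal.

HB.instance Definition _ := GRing.Zmodule.on envelope.
HB.instance Definition _ := EqQuotient.on envelope.

Definition envelope_pi (a : free_ring) : envelope := \pi_envelope a.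

Definition envelope_one : envelope := envelope_pi 1.

Definition envelope_mul (u v : envelope) : envelope :=
  envelope_pi (repr u * repr v).

Lemma envelope_piP (a b : free_ring) :
  envelope_pi a = envelope_pi b <-> ideal_gen envelope_rel (a - b).
Proof.
rewrite /envelope_pi; split=> [/eqP|Iab].
  by rewrite -Quotient.idealrBE => /asboolP.
by apply/eqP; rewrite -Quotient.idealrBE; apply/asboolP.
Qed.

Lemma envelope_piK (u : envelope) : envelope_pi (repr u) = u.
Proof. exact: reprK. Qed.

Lemma envelope_piD : {morph envelope_pi : a b / a + b}.
Proof. by move=> a b; rewrite /envelope_pi Quotient.pi_add. Qed.

Lemma envelope_piN : {morph envelope_pi : a / - a}.
Proof. by move=> a; rewrite /envelope_pi Quotient.pi_opp. Qed.

Lemma envelope_piM (a b : free_ring) :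
  envelope_mul (envelope_pi a) (envelope_pi b) = envelope_pi (a * b).
Proof.
have [[_ IB] IM] := ideal_gen_ideal envelope_rel.
rewrite /envelope_mul; apply/envelope_piP.
set a' := repr _; set b' := repr _.
have Ia : ideal_gen envelope_rel (a' - a) by apply/envelope_piP/envelope_piK.
have Ib : ideal_gen envelope_rel (b - b').
  by apply/envelope_piP; rewrite envelope_piK.
have -> : a' * b' - a * b = (a' - a) * b' - a * (b - b').
  by rewrite mulrBl mulrBr opprB addrA addrNK.
by apply: IB; [case: (IM b' _ Ia)|case: (IM a _ Ib)].
Qed.

Lemma envelope_mulA : associative envelope_mul.
Proof.
move=> u v w; rewrite -(envelope_piK u) -(envelope_piK v) -(envelope_piK w).
by rewrite !envelope_piM mulrA.
Qed.

Lemma envelope_mul1r : left_id envelope_one envelope_mul.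
Proof. by move=> u; rewrite -(envelope_piK u) envelope_piM mul1r. Qed.

Lemma envelope_mulr1 : right_id envelope_one envelope_mul.
Proof. by move=> u; rewrite -(envelope_piK u) envelope_piM mulr1. Qed.

Lemma envelope_mulDl : left_distributive envelope_mul +%R.
Proof.
move=> u v w; rewrite -(envelope_piK u) -(envelope_piK v) -(envelope_piK w).
by rewrite -envelope_piD !envelope_piM mulrDl envelope_piD.
Qed.

Lemma envelope_mulDr : right_distributive envelope_mul +%R.
Proof.
move=> u v w; rewrite -(envelope_piK u) -(envelope_piK v) -(envelope_piK w).
by rewrite -envelope_piD !envelope_piM mulrDr envelope_piD.
Qed.

HB.instance Definition _ := GRing.Zmodule_isPzRing.Build envelope
  envelope_mulA envelope_mul1r envelope_mulr1 envelope_mulDl envelope_mulDr.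

Definition envelope_map (x : L) : envelope := envelope_pi (free_gen x).

Lemma envelope_mapD : {morph envelope_map : x y / x + y}.
Proof.
move=> x y; rewrite /envelope_map -envelope_piD; apply/envelope_piP.
by apply: ideal_gen_sub; left; exists x, y.
Qed.

Lemma envelope_map_bracket (x y : L) :
  envelope_map (bracket x y)
  = envelope_map x * envelope_map y - envelope_map y * envelope_map x.
Proof.
rewrite /envelope_map.
rewrite [X in X - _]envelope_piM [X in _ - X]envelope_piM.
rewrite -envelope_piN -envelope_piD.
by apply/envelope_piP; apply: ideal_gen_sub; right; exists x, y.
Qed.

Lemma envelope_pi_zmod_morphism : zmod_morphism envelope_pi.
Proof. by move=> a b; rewrite envelope_piD envelope_piN. Qed.

HB.instance Definition _ :=
  GRing.isZmodMorphism.Build free_ring envelope envelope_pi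
    envelope_pi_zmod_morphism.

Lemma envelope_pi_monoid_morphism : monoid_morphism envelope_pi.
Proof. by split=> // a b; rewrite [RHS]envelope_piM. Qed.

HB.instance Definition _ :=
  GRing.isMonoidMorphism.Build free_ring envelope envelope_pi
    envelope_pi_monoid_morphism.

Section Universal.
Variables (A : nzRingType) (f : L -> A).

Definition free_mon (m : fmonom L) : A := \prod_(x <- fmonom_val m) f x.

Lemma free_mon_mmorphism : mmorphism free_mon.
Proof.
split=> [m1 m2|]; rewrite /free_mon; last by rewrite fm1 big_nil.
by rewrite fmM big_cat.
Qed.

HB.instance Definition _ :=
  monalg.isMultiplicative.Build (fmonom L) A free_mon free_mon_mmorphism.

Definition free_lift : free_ring -> A := mmap intr free_mon.

Lemma free_lift_zmod_morphism : zmod_morphism free_lift.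
Proof. by move=> a b; rewrite /free_lift mmapB. Qed.

HB.instance Definition _ :=
  GRing.isZmodMorphism.Build free_ring A free_lift free_lift_zmod_morphism.

Lemma free_lift_monoid_morphism : monoid_morphism free_lift.
Proof.
have [|gM g1] := @commr_mmap_is_multiplicative _ _ _ intr free_mon.
  by move=> g m m'; apply/commr_sym/commr_int.
by split.
Qed.

HB.instance Definition _ :=
  GRing.isMonoidMorphism.Build free_ring A free_lift free_lift_monoid_morphism.

Lemma free_liftE (x : L) : free_lift (free_gen x) = f x.
Proof. by rewrite /free_lift mmapU /free_mon fmU big_seq1 mul1r. Qed.

Hypothesis fD : {morph f : x y / x + y}.
Hypothesis fB : forall x y, f (bracket x y) = f x * f y - f y * f x.

Lemma free_lift_ideal (a : free_ring) :
  ideal_gen envelope_rel a -> free_lift a = 0.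
Proof.
move=> /(_ [set a | free_lift a = 0]); apply; split.
  split; first split=> /= [|x y]; rewrite ?raddf0 //.
    by rewrite raddfB /= => -> ->; rewrite subrr.
  by move=> b x /= x0; rewrite !rmorphM /= x0 mulr0 mul0r.
move=> r /= [] [x] [y] ->.
  by rewrite raddfB raddfD /= !free_liftE fD subrr.
by rewrite !(raddfB free_lift) /= !(rmorphM free_lift) /= !free_liftE fB subrr.
Qed.

Definition envelope_lift (u : envelope) : A := free_lift (repr u).

Lemma envelope_lift_pi (a : free_ring) :
  envelope_lift (envelope_pi a) = free_lift a.
Proof.
apply/eqP; rewrite -subr_eq0 -raddfB; apply/eqP/free_lift_ideal.
by apply/envelope_piP; rewrite envelope_piK.
Qed.

Lemma envelope_lift_zmod_morphism : zmod_morphism envelope_lift.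
Proof.
move=> u v; rewrite -(envelope_piK u) -(envelope_piK v) -raddfB.
by rewrite !envelope_lift_pi raddfB.
Qed.

Lemma envelope_lift_monoid_morphism : monoid_morphism envelope_lift.
Proof.
split; first by rewrite (envelope_lift_pi 1) rmorph1.
move=> u v; rewrite -(envelope_piK u) -(envelope_piK v) -rmorphM.
by rewrite !envelope_lift_pi rmorphM.
Qed.

Lemma envelope_lift_exists :
  exists g : {rmorphism envelope -> A}, forall x, g (envelope_map x) = f x.
Proof.
pose gZ := GRing.isZmodMorphism.Build _ _ _ envelope_lift_zmod_morphism.
pose gM := GRing.isMonoidMorphism.Build _ _ _ envelope_lift_monoid_morphism.
pose g : {rmorphism envelope -> A} := HB.pack envelope_lift gZ gM.
by exists g => x; rewrite [LHS]envelope_lift_pi free_liftE.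
Qed.

Lemma envelope_lift_unique (g h : {rmorphism envelope -> A}) :
  (forall x, g (envelope_map x) = h (envelope_map x)) -> g =1 h.
Proof.
move=> gh u; rewrite -(envelope_piK u) (monalgE (repr u)) !raddf_sum.
apply: eq_bigr => m _; move: (_@_m) => c.
have -> : << c *g m >> = << m >> *~ c :> free_ring.
  by rewrite -raddfMz /= intz.
rewrite !raddfMz /=; congr (_ *~ c).
have -> : << m >> = \prod_(x <- fmonom_val m) free_gen x :> free_ring.
  rewrite -{1}(fmK m); elim: (fmonom_val m) => [|x s IH].
    by rewrite big_nil -fmoneE.
  rewrite big_cons -IH /free_gen [RHS]fgmulUU mulr1; congr << _ >>.
  by apply/eqP; rewrite fmP fmM fmU.
elim: (fmonom_val m) => [|x s IH]; first by rewrite big_nil !rmorph1.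
by rewrite big_cons !rmorphM IH; congr (_ * _); exact: gh.
Qed.

End Universal.

End Envelope.

Definition aug_ideal (L : lieRingType) : set (envelope L) :=
  ideal_gen (range (@envelope_map L)).
Arguments aug_ideal L : clear implicits.

Definition lie_dim (L : lieRingType) (n : nat) : set L :=
  @envelope_map L @^-1` ideal_pow (aug_ideal L) n.
Arguments lie_dim L n : clear implicits.

(* Main.v *)
(** Let [A = L'] and let [B / A] be a finitely generated subgroup of [L / A].  We
    look for a function [f] on words in [B] that is additive in each letter, with
    [f (p x y q) - f (p y x q) = f (p [x,y] q)], with [f (x) = 2 x], and sending
    words of length [k] into [gamma_k].  Such an [f] is an additive functional on
    the enveloping ring; a relation placing [x] in the n-th power of the
    augmentation ideal [W] involves only finitely many letters, so taking [B] large
    enough gives [2 x = f (x)] in [gamma_n].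

    Choose [y_1, ..., y_r] decomposing [B / A] into cyclic groups of orders
    [d_1 | ... | d_r] ([0] meaning infinite order).  The quotient [W / W A] suggests
    a functional [g] with [g (a s_1 ... s_k) = [...[a, s_1], ..., s_k]] for [a] in
    [A], and [g (u a v) = 0] for nonempty [u].  Normalise a word by moving a letter
    [y_i] of greatest index to the front, and let [g] vanish on normal words.  As
    this pivot has the largest order, the Jacobi identity shows that [g] respects
    the torsion of [B / A] on words of length at least 3.  There
    [f (w) = g (w) + (-1)^(|w| - 1) g (rev w)] has all the required properties, and
    it is continued by [f (x y) = [x, y]] and [f (x) = 2 x]: the factor 2 is the
    price of the two summands, neither of which extends to words of length 2. *)

Require Import Defs.
From HB Require Import structures.
From mathcomp Require Import all_boot all_order all_algebra.
From mathcomp Require Import ring_quotient monalg finmap.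
From mathcomp Require Import boolp classical_sets.

Set Implicit Arguments.
Unset Strict Implicit.
Unset Printing Implicit Defensive.

Import Order.TTheory GRing.Theory Num.Theory.
Local Open Scope classical_set_scope.
Local Open Scope ring_scope.

(** * Closure properties of additive subgroups *)

Section AdditiveSubgroup.
Variables (V : zmodType) (A : set V).
Hypothesis hA : additive_subgroup A.

Lemma subgroup0 : A 0. Proof. by case: hA. Qed.

Lemma subgroupB x y : A x -> A y -> A (x - y).
Proof. by case: hA => _; apply. Qed.

Lemma subgroupN x : A x -> A (- x).
Proof. by rewrite -[- x]sub0r; apply: subgroupB subgroup0. Qed.

Lemma subgroupD x y : A x -> A y -> A (x + y).
Proof. by move=> Ax Ay; rewrite -[y]opprK; apply/subgroupB/subgroupN. Qed.

Lemma subgroupMz x (k : int) : A x -> A (x *~ k).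
Proof.
move=> Ax; have AM n : A (x *+ n).
  by elim: n => [|n IH]; [exact: subgroup0|rewrite mulrS; exact: subgroupD].
by case: k => n; [exact: AM|apply/subgroupN/AM].
Qed.

Lemma subgroup_sum (I : Type) (r : seq I) (P : pred I) (F : I -> V) :
  (forall i, P i -> A (F i)) -> A (\sum_(i <- r | P i) F i).
Proof. by move=> AF; apply: big_ind => //; [exact: subgroup0|exact: subgroupD]. Qed.

End AdditiveSubgroup.

Lemma zspan_subgroup (V : zmodType) (S : set V) : additive_subgroup (zspan S).
Proof.
split=> [I [[I0 _] _]//|x y Sx Sy I HI].
by case: (HI) => -[_ IB] _; apply: IB; [exact: Sx|exact: Sy].
Qed.

Lemma sub_zspan (V : zmodType) (S : set V) : S `<=` zspan S.
Proof. by move=> x Sx I [_]; apply. Qed.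

Lemma lcs_subgroup (L : lieRingType) n : additive_subgroup (lcs L n).
Proof. by case: n => [|[|n]] //; exact: zspan_subgroup. Qed.

(** * Bracket calculus and the right-normed action of words on a Lie ring *)

Section LieRing.
Variable L : lieRingType.
Implicit Types (x y z a c : L) (s : seq L).

Lemma bracketC x y : bracket x y = - bracket y x.
Proof.
apply/eqP; rewrite -addr_eq0; apply/eqP.
have := bracketxx (x + y).
by rewrite bracketDl !bracketDr !bracketxx add0r addr0.
Qed.

Lemma bracket_zmod_morphism x : zmod_morphism (bracket x).
Proof.
move=> y z; apply/(canRL (addrK (bracket x z))).
by rewrite -bracketDr subrK.
Qed.

HB.instance Definition _ x :=
  GRing.isZmodMorphism.Build L L (bracket x) (bracket_zmod_morphism x).

Lemma bracketMzr x y k : bracket x (y *~ k) = bracket x y *~ k.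
Proof. exact: raddfMz. Qed.

Lemma bracketMzl x y k : bracket (x *~ k) y = bracket x y *~ k.
Proof. by rewrite bracketC bracketMzr -mulNrz -bracketC. Qed.

Lemma bracket0l y : bracket 0 y = 0.
Proof. by rewrite bracketC raddf0 oppr0. Qed.

Lemma bracketNl x y : bracket (- x) y = - bracket x y.
Proof. by rewrite [LHS]bracketC raddfN [in RHS]bracketC. Qed.

Lemma bracketBl x y z : bracket (x - y) z = bracket x z - bracket y z.
Proof. by rewrite bracketDl bracketNl. Qed.

Lemma bracket_suml (I : Type) (r : seq I) (P : pred I) (F : I -> L) y :
  bracket (\sum_(i <- r | P i) F i) y = \sum_(i <- r | P i) bracket (F i) y.
Proof.
by rewrite bracketC raddf_sum -sumrN; apply: eq_bigr => i _; rewrite -bracketC.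
Qed.

Lemma jacobil x y z :
  bracket (bracket x y) z = bracket (bracket x z) y + bracket x (bracket y z).
Proof.
rewrite (bracketC _ z) (bracketC (bracket x z)) (bracketC x z) raddfN opprK.
apply: (addIr (bracket z (bracket x y))).
by rewrite addNr (addrC (bracket y _)) jacobi.
Qed.

Lemma derived_subgroup : additive_subgroup (derived L).
Proof. exact: zspan_subgroup. Qed.

Lemma derived_bracket x y : derived L (bracket x y).
Proof. by apply: sub_zspan; exists x, y. Qed.

Lemma lcs_bracket n a x : lcs L n.+1 a -> lcs L n.+2 (bracket a x).
Proof.
move=> La; rewrite bracketC; apply: (subgroupN (lcs_subgroup L n.+2)).
by apply: sub_zspan; exists x, a.
Qed.

Lemma lcs2_bracket x y : lcs L 2 (bracket x y).
Proof. exact: (@lcs_bracket 0). Qed.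

Lemma lcs_succ n : lcs L n.+1 `<=` lcs L n.
Proof.
case: n => [|n] //; elim: n => [|n IH] // x.
move=> Lx; apply: Lx; split; first exact: lcs_subgroup.
by move=> _ [a [b [_ Lb ->]]]; apply: sub_zspan; exists a, b; split=> //; exact: IH.
Qed.

Lemma lcs_le m n : (m <= n)%N -> lcs L n `<=` lcs L m.
Proof.
move=> /subnK <-; elim: (n - m)%N => // k IH x.
by rewrite addSn => /lcs_succ; exact: IH.
Qed.

Definition act s a : L := foldl bracket a s.

Arguments act : simpl never.

Lemma act_cons a x s : act (x :: s) a = act s (bracket a x).
Proof. by []. Qed.

Lemma act_zmod_morphism s : zmod_morphism (act s).
Proof. by elim: s => [|x s IH] a b //; rewrite !act_cons bracketBl IH. Qed.

HB.instance Definition _ s :=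
  GRing.isZmodMorphism.Build L L (act s) (act_zmod_morphism s).

Lemma act0 s : act s 0 = 0. Proof. exact: raddf0. Qed.

Lemma actN s a : act s (- a) = - act s a. Proof. exact: raddfN. Qed.

Lemma actD s a b : act s (a + b) = act s a + act s b.
Proof. exact: raddfD. Qed.

Lemma actMz s a k : act s (a *~ k) = act s a *~ k.
Proof. exact: raddfMz. Qed.

Lemma act_additive a p x y s :
  act (p ++ (x + y) :: s) a = act (p ++ x :: s) a + act (p ++ y :: s) a.
Proof.
elim: p a => [|z p IH] a; last by rewrite !act_cons IH.
by rewrite !act_cons bracketDr raddfD.
Qed.

Lemma lcs_act n a s : lcs L n.+1 a -> lcs L (n + size s).+1 (act s a).
Proof.
elim: s n a => [|x s IH] n a La; first by rewrite /= addn0.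
by rewrite act_cons [size _]/= -addSnnS; apply: IH; apply: lcs_bracket.
Qed.

Hypothesis hL : metabelian L.

Lemma metabelian_bracket a b : derived L a -> derived L b -> bracket a b = 0.
Proof.
move=> La Lb; have: derived2 L (bracket a b) by apply: sub_zspan; exists a, b.
by rewrite (hL : derived2 L = _).
Qed.

(** By the Jacobi identity the two sides differ by [[c, [x, y]]], a bracket of two derived elements.
    Hence [derived L] is a module over a commutative ring, and the order of the letters in [act]
    does not matter there. *)
Lemma metabelian_bracketAC c x y : derived L c ->
  bracket (bracket c x) y = bracket (bracket c y) x.
Proof.
move=> Lc; rewrite jacobil (metabelian_bracket Lc (derived_bracket x y)).
exact: addr0.
Qed.

Lemma act_swap p x y s c : derived L c ->
  act (p ++ x :: y :: s) c = act (p ++ y :: x :: s) c.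
Proof.
elim: p c => [|z p IH] c Lc; rewrite ?cat_cons !act_cons.
  by rewrite metabelian_bracketAC.
by apply: IH; apply: derived_bracket.
Qed.

Lemma act_derived_eq0 c p a s : derived L c -> derived L a ->
  act (p ++ a :: s) c = 0.
Proof.
move=> Lc La; elim: p c Lc => [|x p IH] c Lc; rewrite ?cat_cons act_cons.
  by rewrite metabelian_bracket ?raddf0.
by apply: IH; apply: derived_bracket.
Qed.

End LieRing.

(** * The functional [g] of the overview, computed on letters with coordinates *)

Section Pivot.
Variables (L : lieRingType) (r : nat) (y : 'I_r -> L).

Let letter : zmodType := ('rV[int]_r * L)%type.
Implicit Types (t u v x z : letter) (p q s : seq letter) (a c : L) (i j : 'I_r).
Implicit Types (f : int).

(* A letter [(f, l)] stands for [l] in [L] together with coordinates [f] such that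
   [l] is [\sum_j y j *~ f 0 j] modulo [derived L] (see [near_basis]); [trunc k]
   removes the components of index [>= k]. *)
Definition trunc (k : nat) t : L :=
  t.2 - \sum_(j < r | (k <= j)%N) y j *~ t.1 0 j.

Lemma trunc_zmod_morphism k : zmod_morphism (trunc k).
Proof.
move=> t u; rewrite /trunc.
under eq_bigr => j _ do rewrite !mxE mulrzBr.
by rewrite sumrB !opprD !opprK addrACA.
Qed.

HB.instance Definition _ k :=
  GRing.isZmodMorphism.Build letter L (trunc k) (trunc_zmod_morphism k).

Lemma truncD k t u : trunc k (t + u) = trunc k t + trunc k u.
Proof. exact: raddfD. Qed.

Lemma trunc_ge k t : (r <= k)%N -> trunc k t = t.2.
Proof.
move=> le_rk; rewrite /trunc big1 ?subr0 // => j le_kj.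
by have := leq_trans le_rk le_kj; rewrite leqNgt ltn_ord.
Qed.

Lemma truncS i t : trunc i.+1 t = trunc i t + y i *~ t.1 0 i.
Proof.
rewrite /trunc [in RHS](bigD1 i) //= opprD addrA addrAC subrK.
congr (_ - _); apply: eq_bigl => j.
by rewrite ltn_neqAle andbC eq_sym.
Qed.

Lemma bracket_truncS i t : bracket (trunc i.+1 t) (y i) = bracket (trunc i t) (y i).
Proof. by rewrite truncS bracketDl bracketMzl bracketxx mul0rz addr0. Qed.

Lemma trunc_coord0 k a : trunc k (0, a) = a.
Proof. by rewrite /trunc big1 ?subr0 // => j _; rewrite mxE mulr0z. Qed.

(* For [c] in [derived L] acting by [act], the difference between letters truncated
   at [i.+1] and at [i], with one factor [y i] already absorbed in [c]. *)
Fixpoint pivot_sum i s c : L :=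
  if s is t :: s' then
    act (map (trunc i.+1) s') c *~ t.1 0 i + pivot_sum i s' (bracket c (trunc i t))
  else 0.

Lemma pivot_sum_zmod_morphism i s : zmod_morphism (pivot_sum i s).
Proof.
elim: s => [|t s IH] a b /=; first by rewrite subr0.
by rewrite bracketBl IH raddfB mulrzBl opprD addrACA.
Qed.

HB.instance Definition _ i s :=
  GRing.isZmodMorphism.Build L L (pivot_sum i s) (pivot_sum_zmod_morphism i s).

Lemma pivot_sumD i p u v q c :
  pivot_sum i (p ++ (u + v) :: q) c
  = pivot_sum i (p ++ u :: q) c + pivot_sum i (p ++ v :: q) c.
Proof.
elim: p c => [|w p IH] c /=.
  by rewrite mxE mulrzDr truncD bracketDr raddfD addrACA.
by rewrite !map_cat /= truncD act_additive IH mulrzDl addrACA.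
Qed.

(** The value of [g] on the word [t :: s]. Expand all letters into components; in the [i]-th summand
    the pivot is the leftmost [y i] of the tail, so letters before it only have components of index
    below [i], later ones of index at most [i]. Moving the pivot to the front leaves [[t, y i]]
    acted on by the other letters. If [t] itself has the greatest index the word is normal and
    contributes nothing; a tie vanishes since [[y i, y i] = 0]. *)
Definition pivot_total s t : L :=
  \sum_(i < r) pivot_sum i s (bracket (trunc i.+1 t) (y i)).

Lemma pivot_total_zmod_morphism s : zmod_morphism (pivot_total s).
Proof.
move=> t u; rewrite /pivot_total -sumrB; apply: eq_bigr => i _.
by rewrite raddfB bracketBl raddfB.
Qed.

HB.instance Definition _ s :=
  GRing.isZmodMorphism.Build letter L (pivot_total s) (pivot_total_zmod_morphism s).

Lemma pivot_totalD p u v q t :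
  pivot_total (p ++ (u + v) :: q) t
  = pivot_total (p ++ u :: q) t + pivot_total (p ++ v :: q) t.
Proof. by rewrite -big_split; apply: eq_bigr => i _; rewrite pivot_sumD. Qed.

(** One letter of [s], the pivot, is already absorbed in [c], so only [size s - 1] further brackets
    are taken. *)
Lemma lcs_pivot_sum i s n c :
  lcs L n.+1 c -> lcs L (n + size s) (pivot_sum i s c).
Proof.
elim: s n c => [|t s IH] n c Lc; first exact: (subgroup0 (lcs_subgroup L _)).
rewrite /= addnS; apply: (subgroupD (lcs_subgroup L _)).
  apply: (subgroupMz (lcs_subgroup L _)).
  by have := lcs_act (map (trunc i.+1) s) Lc; rewrite size_map.
by rewrite -addSn; apply: IH; apply: lcs_bracket.
Qed.

Lemma lcs_pivot_total s t : lcs L (size s).+1 (pivot_total s t).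
Proof.
apply: (subgroup_sum (lcs_subgroup L _)) => i _.
by rewrite -add1n; apply: lcs_pivot_sum; exact: lcs2_bracket.
Qed.

Hypothesis hL : metabelian L.
Local Notation A := (derived L).

Definition near_basis t : Prop := A (trunc 0 t).

Lemma pivot_sum_swap i p u v q c : A c ->
  pivot_sum i (p ++ u :: v :: q) c = pivot_sum i (p ++ v :: u :: q) c.
Proof.
elim: p c => [|w p IH] c Ac /=; last first.
  rewrite !map_cat /= act_swap // IH //; exact: derived_bracket.
rewrite metabelian_bracketAC // !addrA; congr (_ + _).
rewrite !truncS !bracketDr !bracketMzr !actD !actMz !mulrzDl.
rewrite [_ *~ u.1 0 i *~ _]mulrzAC.
by rewrite [LHS]addrC [LHS]addrA [LHS]addrAC.
Qed.

(** Replace the letters one at a time: each replacement contributes a coordinate times [y i], and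
    commutativity of the action on [derived L] lets this [y i] act first. *)
Lemma act_trunc i s c : A c ->
  act (map (trunc i.+1) s) c - act (map (trunc i) s) c
  = pivot_sum i s (bracket c (y i)).
Proof.
elim: s c => [|t s IH] c Ac; first by rewrite subrr.
rewrite /= truncS bracketDr bracketMzr actD actMz.
rewrite addrAC IH; last exact: derived_bracket.
by rewrite addrC metabelian_bracketAC.
Qed.

(** The terms whose pivot is [z] or [x] expand the bracket from level [i] to [i.+1]. In the others
    the Jacobi identity produces [[[x, z], y i]], which [act_trunc] turns into a difference of
    actions. The right-hand side is shaped to telescope in [i]. *)
Lemma pivot_sum_exchange i x z s :
  pivot_sum i (z :: s) (bracket (trunc i.+1 x) (y i))
  - pivot_sum i (x :: s) (bracket (trunc i.+1 z) (y i))
  = act (map (trunc i.+1) s) (bracket (trunc i.+1 x) (trunc i.+1 z))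
    - act (map (trunc i) s) (bracket (trunc i x) (trunc i z)).
Proof.
rewrite /= !bracket_truncS opprD addrACA -raddfB /=.
have -> : bracket (bracket (trunc i x) (y i)) (trunc i z)
          - bracket (bracket (trunc i z) (y i)) (trunc i x)
        = bracket (bracket (trunc i x) (trunc i z)) (y i).
  by rewrite [RHS]jacobil [bracket (trunc i x) (bracket _ _)]bracketC.
rewrite -act_trunc; last exact: derived_bracket.
rewrite addrA; congr (_ - _).
rewrite !truncS; move: (trunc i x) (trunc i z) => a b.
rewrite !bracketDl !bracketDr !bracketMzr !bracketMzl bracketxx !mul0rz addr0.
by rewrite !actD !actMz [bracket (y i) _]bracketC actN mulNrz addrC addrA.
Qed.

Lemma pivot_total_exchange x z s : near_basis x -> near_basis z ->
  pivot_total (z :: s) x - pivot_total (x :: s) z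
  = act (map snd s) (bracket x.2 z.2).
Proof.
move=> Ax Az; rewrite -sumrB.
under eq_bigr => i _ do rewrite pivot_sum_exchange.
pose F k := act (map (trunc k) s) (bracket (trunc k x) (trunc k z)).
rewrite -(big_mkord xpredT (fun k => F k.+1 - F k)) telescope_sumr //.
(* At level 0 both truncations lie in [derived L], so the lower end of the telescope vanishes. *)
rewrite /F (metabelian_bracket hL Ax Az) act0 subr0 !trunc_ge //.
by congr (act _ _); apply: eq_map => t; rewrite trunc_ge.
Qed.

Lemma pivot_total_swap p u v q t :
  pivot_total (p ++ u :: v :: q) t = pivot_total (p ++ v :: u :: q) t.
Proof.
apply: eq_bigr => i _; apply: pivot_sum_swap; exact: derived_bracket.
Qed.

Lemma pivot_total_derived a u s : A a -> near_basis u ->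
  pivot_total (u :: s) (0, a) = act (map snd (u :: s)) a.
Proof.
move=> Aa Au; rewrite /pivot_total.
under eq_bigr => i _ do rewrite trunc_coord0 -act_trunc //.
pose F k := act (map (trunc k) (u :: s)) a.
rewrite -(big_mkord xpredT (fun k => F k.+1 - F k)) telescope_sumr //.
rewrite /F [X in _ - X]/= (metabelian_bracket hL Aa Au) act0 subr0.
by congr (act _ _); apply: eq_map => t; rewrite trunc_ge.
Qed.

Lemma pivot_sum_derived i p a q c : A a -> A c -> 
  pivot_sum i (p ++ (0, a) :: q) c = 0.
Proof.
move=> Aa; elim: p c => [|w p IH] c Ac /=.
  by rewrite mxE mulr0z trunc_coord0 metabelian_bracket // raddf0 addr0.
rewrite map_cat /= trunc_coord0 act_derived_eq0 // mul0rz add0r.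
by apply: IH; exact: derived_bracket.
Qed.

Lemma pivot_total_tail_derived p a q t : A a ->
  pivot_total (p ++ (0, a) :: q) t = 0.
Proof.
move=> Aa; apply: big1 => i _; apply: pivot_sum_derived => //.
exact: derived_bracket.
Qed.

(** * Compatibility of the pivot functional with torsion modulo [derived L] *)

Variable d : 'I_r -> int.
Hypothesis d_chain : forall i j, (i <= j)%N -> (d i %| d j)%Z.
Hypothesis d_y : forall i, A (y i *~ d i).

(** These letters measure the ambiguity in the coordinates of an element: see [null_letterB]. *)
Definition null_letter t : Prop := t.2 = 0 /\ forall j, (d j %| t.1 0%R j)%Z.

Lemma derived_yM i f : (d i %| f)%Z -> A (y i *~ f).
Proof.
case/dvdzP=> k ->; rewrite mulrC mulrzA.
by apply: (subgroupMz (derived_subgroup L)).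
Qed.

Lemma trunc_null k t : null_letter t -> A (trunc k t).
Proof.
case=> t0 dt; rewrite /trunc t0 sub0r.
apply: (subgroupN (derived_subgroup L)).
by apply: (subgroup_sum (derived_subgroup L)) => j _; apply: derived_yM.
Qed.

Lemma trunc_prefix k t :
  trunc k t = trunc 0 t + \sum_(j < r | (j < k)%N) y j *~ t.1 0 j.
Proof.
rewrite /trunc [X in _ = _ - X + _](bigID (fun j : 'I_r => (j < k)%N)) /=.
rewrite opprD addrA addrAC subrK; congr (_ - _).
by apply: eq_bigl => j; rewrite -leqNgt.
Qed.

(** Here the pivot of greatest index pays off: only components [y j] with [j <= i] remain, and their
    orders [d j] all divide [d i], hence [f]. *)
Lemma derived_truncM i k t f :
  near_basis t -> (k <= i.+1)%N -> (d i %| f)%Z -> A (trunc k t *~ f).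
Proof.
move=> At le_ki di_f; rewrite trunc_prefix mulrzDl.
apply: (subgroupD (derived_subgroup L)).
  exact: (subgroupMz (derived_subgroup L)).
rewrite mulrz_suml; apply: (subgroup_sum (derived_subgroup L)) => j lt_jk.
rewrite -mulrzA mulrC mulrzA; apply: (subgroupMz (derived_subgroup L)).
apply: derived_yM; apply: dvdz_trans di_f; apply: d_chain.
by rewrite -ltnS (leq_trans lt_jk).
Qed.

Lemma bracket_truncM i k t c f : A c ->
  near_basis t -> (k <= i.+1)%N -> (d i %| f)%Z -> bracket c (trunc k t) *~ f = 0.
Proof.
move=> Ac At le_ki di_f; rewrite -bracketMzr metabelian_bracket //.
exact: (derived_truncM At le_ki).
Qed.

Lemma pivot_sumM i j c f u v s : A c -> (i <= j)%N -> (d j %| f)%Z ->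
  near_basis u -> near_basis v -> pivot_sum i (u :: v :: s) (c *~ f) = 0.
Proof.
move=> Ac le_ij dj_f Au Av.
have kill k t : near_basis t -> (k <= j.+1)%N -> bracket (c *~ f) (trunc k t) = 0.
  by move=> At le_kj; rewrite bracketMzl (@bracket_truncM j).
rewrite /= (kill _ v) // (kill _ u) 1?leqW // bracket0l !act0.
by rewrite !mul0rz raddf0 !addr0.
Qed.

Lemma pivot_sum_null_eq0 i p t q c : A c -> null_letter t ->
  c *~ t.1 0 i = 0 -> pivot_sum i (p ++ t :: q) c = 0.
Proof.
move=> Ac nt; elim: p c Ac => [|w p IH] c Ac ct0 /=.
  rewrite -actMz ct0 act0 add0r metabelian_bracket ?raddf0 //.
  exact: trunc_null.
rewrite map_cat /= act_derived_eq0 //; last exact: trunc_null.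
rewrite mul0rz add0r IH -?bracketMzl ?ct0 ?bracket0l //.
exact: derived_bracket.
Qed.

(** Truncations of [t] lie in [derived L] and act as zero, so [t] can only contribute as the pivot.
    Its coordinate is then a multiple of [d i], which is absorbed by a neighbouring letter through
    [bracket_truncM]; this is why a second tail letter must be present. *)
Lemma pivot_sum_null i p t q c : A c -> null_letter t ->
  (forall u, u \in p ++ q -> near_basis u) -> (0 < size (p ++ q))%N ->
  pivot_sum i (p ++ t :: q) c = 0.
Proof.
move=> Ac nt; have [_ /(_ i) di_t] := nt.
case: p => [|w p] Vpq /= pq_gt0.
  case: q Vpq pq_gt0 => // w q Vpq _ /=.
  have Aw : near_basis w by apply: Vpq; rewrite mem_head.
  rewrite -actMz (@bracket_truncM i) // act0 add0r.
  rewrite metabelian_bracket //; last exact: trunc_null.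
  by rewrite bracket0l act0 mul0rz raddf0 addr0.
have Aw : near_basis w by apply: Vpq; rewrite mem_head.
rewrite map_cat /= act_derived_eq0 //; last exact: trunc_null.
rewrite mul0rz add0r pivot_sum_null_eq0 //; first exact: derived_bracket.
exact: (@bracket_truncM i).
Qed.

Lemma pivot_total_null p t q u : null_letter t ->
  (forall u, u \in p ++ q -> near_basis u) -> (0 < size (p ++ q))%N ->
  pivot_total (p ++ t :: q) u = 0.
Proof.
move=> nt Vpq pq_gt0; apply: big1 => i _; apply: pivot_sum_null => //.
exact: derived_bracket.
Qed.

(** Truncating a null head at [i.+1] leaves multiples of [d j] times [y j] with [j <= i], up to
    sign. The coefficient therefore has to be absorbed by a letter that is not the pivot; two tail
    letters guarantee one, whence words of length at least 3. *)
Lemma pivot_total_null_head t u v s : null_letter t ->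
  near_basis u -> near_basis v -> pivot_total (u :: v :: s) t = 0.
Proof.
move=> [t0 dt] Au Av; apply: big1 => i _.
rewrite /trunc t0 sub0r bracketNl bracket_suml raddfN raddf_sum.
rewrite big1 ?oppr0 // => j /ltnW le_ij.
rewrite bracketMzl; apply: (@pivot_sumM _ j) => //; exact: derived_bracket.
Qed.

End Pivot.

Record trace_on (L : lieRingType) (B : set L) (f : seq L -> L) : Prop := {
  traceD : forall p x y q, (forall u, u \in p ++ q -> B u) -> B x -> B y ->
    f (p ++ (x + y) :: q) = f (p ++ x :: q) + f (p ++ y :: q);
  trace_bracket : forall p x y q,
    (forall u, u \in p ++ q -> B u) -> B x -> B y ->
    f (p ++ x :: y :: q) - f (p ++ y :: x :: q) = f (p ++ bracket x y :: q);
  trace_lcs : forall w, lcs L (size w) (f w);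
  trace1 : forall x, f [:: x] = x *+ 2
}.

(** * From letters with coordinates to words in the Lie ring, and the trace [f] *)

Section PivotWord.
Variables (L : lieRingType) (r : nat) (y : 'I_r -> L) (d : 'I_r -> int).
Local Notation A := (derived L).
Hypothesis hL : metabelian L.
Hypothesis d_chain : forall i j : 'I_r, (i <= j)%N -> (d i %| d j)%Z.
Hypothesis d_y : forall i, A (y i *~ d i).
Hypothesis y_rel : forall f : 'rV[int]_r,
  A (\sum_j y j *~ f 0 j) -> forall j, (d j %| f 0%R j)%Z.

Let letter : zmodType := ('rV[int]_r * L)%type.
Implicit Types (t u v : letter) (a x z : L).

Definition word_val (w : seq letter) : L :=
  if w is t :: s then pivot_total y s t else 0.

Lemma word_valD p u v q :
  word_val (p ++ (u + v) :: q) = word_val (p ++ u :: q) + word_val (p ++ v :: q).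
Proof. by case: p => [|w p]; [exact: raddfD|exact: pivot_totalD]. Qed.

Lemma word_val_null p t q : null_letter d t ->
  (forall u, u \in p ++ q -> near_basis y u) -> (1 < size (p ++ q))%N ->
  word_val (p ++ t :: q) = 0.
Proof.
move=> nt; case: p => [|w p] Vpq; last first.
  move=> s_gt0; apply: (pivot_total_null hL d_chain d_y) => // u pq_u.
  by apply: Vpq; rewrite inE pq_u orbT.
case: q Vpq => [|u [|v q]] Vpq // _.
by apply: (pivot_total_null_head hL d_chain d_y) => //; apply: Vpq;
  rewrite !inE eqxx ?orbT.
Qed.

Lemma null_letterB t u : near_basis y t -> near_basis y u -> t.2 = u.2 ->
  null_letter d (t - u).
Proof.
move=> At Au tu; split; first by rewrite /= tu subrr.
apply: y_rel; have: A (- trunc y 0 (t - u)).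
  apply: (subgroupN (derived_subgroup L)); rewrite raddfB.
  exact: (subgroupB (derived_subgroup L)).
by rewrite /trunc /= tu subrr sub0r opprK.
Qed.

Lemma word_val_congr p t u q :
  (forall v, v \in p ++ q -> near_basis y v) -> (1 < size (p ++ q))%N ->
  near_basis y t -> near_basis y u -> t.2 = u.2 ->
  word_val (p ++ t :: q) = word_val (p ++ u :: q).
Proof.
move=> Vpq pq_gt1 At Au tu; rewrite -[t](subrK u) word_valD.
by rewrite (word_val_null (null_letterB At Au tu)) ?add0r.
Qed.

Definition spanned : set L := [set x | exists t, near_basis y t /\ t.2 = x].

(** An arbitrary choice of coordinates, with a dummy value outside [spanned]. By [word_val_congr]
    the choice is immaterial in words of length at least 3. *)
Definition lift_letter x : letter := xget 0 [set t | near_basis y t /\ t.2 = x].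

Lemma lift_letterP x : spanned x ->
  near_basis y (lift_letter x) /\ (lift_letter x).2 = x.
Proof. exact: xgetPex. Qed.

Lemma near_lift x : spanned x -> near_basis y (lift_letter x).
Proof. by case/lift_letterP. Qed.

Lemma lift_snd x : spanned x -> (lift_letter x).2 = x.
Proof. by case/lift_letterP. Qed.

Lemma near_basisD t u : near_basis y t -> near_basis y u -> near_basis y (t + u).
Proof.
move=> At Au; rewrite /near_basis truncD.
exact: (subgroupD (derived_subgroup L)).
Qed.

Lemma near_derived a : A a -> near_basis y (0, a).
Proof. by rewrite /near_basis trunc_coord0. Qed.

Lemma near_map_lift (s : seq L) : (forall z, z \in s -> spanned z) ->
  forall t, t \in map lift_letter s -> near_basis y t.
Proof. by move=> Ss _ /mapP[z sz ->]; apply: near_lift; apply: Ss. Qed.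

Lemma snd_map_lift (s : seq L) : (forall z, z \in s -> spanned z) ->
  map snd (map lift_letter s) = s.
Proof.
by move=> Ss; rewrite -map_comp map_id_in // => u /Ss/lift_snd.
Qed.

Definition pivot_word (w : seq L) : L := word_val (map lift_letter w).

Lemma pivot_word_congr p x t q :
  (forall z, z \in p ++ q -> spanned z) -> (1 < size (p ++ q))%N ->
  near_basis y t -> t.2 = x ->
  pivot_word (p ++ x :: q)
  = word_val (map lift_letter p ++ t :: map lift_letter q).
Proof.
move=> Spq pq_gt1 At <-; have St : spanned t.2 by exists t.
rewrite /pivot_word map_cat /=; apply: word_val_congr => //.
- by rewrite -map_cat; exact: near_map_lift.
- by rewrite -map_cat size_map.
- exact: near_lift.
- exact: lift_snd.
Qed.

Lemma pivot_wordD p x z q :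
  (forall z, z \in p ++ q -> spanned z) -> (1 < size (p ++ q))%N ->
  spanned x -> spanned z ->
  pivot_word (p ++ (x + z) :: q)
  = pivot_word (p ++ x :: q) + pivot_word (p ++ z :: q).
Proof.
move=> Spq pq_gt1 Sx Sz.
rewrite (@pivot_word_congr _ (x + z) (lift_letter x + lift_letter z)) //.
- by rewrite word_valD /pivot_word !map_cat.
- by apply: near_basisD; exact: near_lift.
- by rewrite /= !lift_snd.
Qed.

Lemma pivot_word_exchange p x z q :
  (forall z, z \in p ++ q -> spanned z) -> spanned x -> spanned z ->
  pivot_word (p ++ x :: z :: q) - pivot_word (p ++ z :: x :: q)
  = if nilp p then act q (bracket x z) else 0.
Proof.
rewrite /pivot_word !map_cat; case: p => [|w p] Sq Sx Sz /=.
  rewrite pivot_total_exchange ?snd_map_lift ?lift_snd //; exact: near_lift.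
by rewrite pivot_total_swap ?subrr.
Qed.

Lemma pivot_word_derived p a q :
  (forall z, z \in p ++ q -> spanned z) -> (1 < size (p ++ q))%N -> A a ->
  pivot_word (p ++ a :: q) = if nilp p then act q a else 0.
Proof.
move=> Spq pq_gt1 Aa; rewrite (pivot_word_congr Spq pq_gt1 (near_derived Aa)) //.
case: p Spq pq_gt1 => [|w p] Sq q_gt1 /=; last exact: pivot_total_tail_derived.
case: q Sq q_gt1 => // u q Sq _; rewrite map_cons pivot_total_derived //.
  by rewrite -map_cons snd_map_lift.
by apply: near_lift; apply: Sq; rewrite mem_head.
Qed.

Lemma lcs_pivot_word w : lcs L (size w) (pivot_word w).
Proof.
rewrite /pivot_word; case: w => [|x s] //=.
by have := lcs_pivot_total y (map lift_letter s) (lift_letter x); rewrite size_map.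
Qed.

Definition metabelian_trace (w : seq L) : L :=
  match w with
  | [::] => 0
  | [:: x] => x *+ 2
  | [:: x; z] => bracket x z
  | _ => pivot_word w - pivot_word (rev w) *~ (-1) ^+ size w
  end.

Lemma metabelian_trace_long w : (2 < size w)%N ->
  metabelian_trace w = pivot_word w - pivot_word (rev w) *~ (-1) ^+ size w.
Proof. by case: w => [|x [|z [|]]]. Qed.

Lemma metabelian_trace_on : trace_on spanned metabelian_trace.
Proof.
split=> [p x z q Spq Sx Sz|p x z q Spq Sx Sz|w|//].
- have [|pq_le1] := ltnP 1 (size (p ++ q)).
    rewrite size_cat => pq_gt1.
    have Srev (u : L) : u \in rev q ++ rev p -> spanned u.
      by rewrite -rev_cat mem_rev; exact: Spq.
    rewrite !metabelian_trace_long ?size_cat /= ?addnS //.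
    rewrite !rev_cat !rev_cons !cat_rcons !pivot_wordD //.
    + by rewrite mulrzDl opprD addrACA.
    + by rewrite -rev_cat size_rev size_cat.
    + by rewrite size_cat.
  case: p q pq_le1 {Spq} => [|u [|v p]] [|w [|w' q]] //= _; last exact: bracketDr.
    by rewrite mulrnDl.
  exact: bracketDl.
- have [|pq_gt0] := leqP (size (p ++ q)) 0.
    (* Empty context: [[x, z] - [z, x]] is twice [[x, z]], which dictates the factor 2 on single
       letters. *)
    case: p q {Spq} => [|//] [|//] _ /=.
    by rewrite [bracket z x]bracketC opprK mulr2n.
  have Srev (u : L) : u \in rev q ++ rev p -> spanned u.
    by rewrite -rev_cat mem_rev; exact: Spq.
  rewrite !(@metabelian_trace_long (p ++ _ :: _ :: q)) ?size_cat /= ?addnS ?ltnS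
    -?size_cat //.
  rewrite !rev_cat !rev_cons !cat_rcons.
  rewrite opprD addrACA pivot_word_exchange // -opprD -mulrzBl.
  rewrite pivot_word_exchange //.
  have [pq_gt1|pq_le1] := ltnP 1 (size (p ++ q)).
    rewrite metabelian_trace_long ?size_cat /= ?addnS -?size_cat //.
    rewrite !rev_cat !rev_cons !cat_rcons.
    rewrite !pivot_word_derived //; try exact: derived_bracket.
      (* Dropping one letter flips the sign [(-1) ^+ size w]; this compensates for the reversed word
         producing [[z, x]] in place of [[x, z]]. *)
      rewrite exprS mulN1r mulrNz; congr (_ - _).
      rewrite -mulNrz; congr (_ *~ _).
      by case: ifP => _; rewrite ?oppr0 // -actN -bracketC.
    by rewrite -rev_cat size_rev.
  (* Length 3 drops to length 2, where [f] is the plain bracket. Exactly one summand contributes: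
     the direct one if the extra letter is on the right, the reversed one if it is on the left. *)
  case: p q pq_gt0 pq_le1 {Spq Srev} => [|u [|v p]] [|w [|v' q]] //= _ _.
    by rewrite mul0rz subr0.
  rewrite sub0r -[_ ^+ _]/(-1) mulrNz mulr1z opprK.
  by rewrite [RHS]bracketC -bracketNl -bracketC.
- case: (ltnP 2 (size w)) => [w_gt2|]; last first.
    by case: w => [|x [|z [|]]] // _; exact: lcs2_bracket.
  rewrite metabelian_trace_long //; apply: (subgroupB (lcs_subgroup L _)).
    exact: lcs_pivot_word.
  apply: (subgroupMz (lcs_subgroup L _)).
  by rewrite -size_rev; exact: lcs_pivot_word.
Qed.

End PivotWord.

(** * Cyclic decomposition of a finitely generated abelian group *)

Lemma int_subgroup_principal (D : set int) : additive_subgroup D ->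
  exists d : int, forall x, D x <-> (d %| x)%Z.
Proof.
move=> hD; have [[n /andP[n_gt0 /asboolP Dn]]|D0] :=
  pselect (exists n : nat, (0 < n)%N && `[< D n%:Z >]).
- have ex_n : exists n : nat, (0 < n)%N && `[< D n%:Z >].
    by exists n; rewrite n_gt0; apply/asboolP.
  case: (ex_minnP ex_n) => d /andP[d_gt0 /asboolP Dd] d_min.
  exists d%:Z => x; split=> [Dx|/dvdzP[q ->]]; last first.
    by rewrite mulrC -mulrzz; exact: subgroupMz.
  have d_neq0 : d%:Z != 0 by rewrite -lt0n.
  rewrite dvdzE; apply/dvdz_mod0P.
  have Dr : D (x %% d)%Z.
    by rewrite /modz mulrC -mulrzz; apply: subgroupB => //; exact: subgroupMz.
  have := ltz_pmod x (d_gt0 : 0 < d%:Z); have := modz_ge0 x d_neq0.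
  case: (x %% d)%Z Dr => // [[|k]] // Dk _; rewrite ltz_nat ltnNge d_min //.
  exact/asboolP.
- exists 0 => x; rewrite dvd0z; split=> [Dx|/eqP->]; last exact: subgroup0.
  apply: contra_notT D0 => x_neq0; exists `|x|%N; rewrite absz_gt0 x_neq0.
  apply/asboolP; rewrite abszE; case: (ler0P x) => _ //.
  exact: subgroupN.
Qed.

(** Induction on [r]: the first coordinates form a principal subgroup generated by some [d],
    attained by a row [(d, w)]. Subtracting a multiple of this row reduces to rows with first
    coordinate 0. The matrix is square because zero rows are allowed. *)
Lemma row_subgroup_span r (K : set 'rV[int]_r) : additive_subgroup K ->
  exists M : 'M[int]_r, forall v, K v <-> exists u, v = u *m M.
Proof.
elim: r K => [|r IH] K hK.
  exists 0 => v; rewrite thinmx0; split=> _; last exact: subgroup0.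
  by exists 0; rewrite mul0mx.
pose D : set int := [set x | exists w : 'rV_r, K (row_mx x%:M w)].
have hD : additive_subgroup D.
  split=> [|x x' [w Kw] [w' Kw']].
    by exists 0; rewrite raddf0 row_mx0; exact: subgroup0.
  exists (w - w'); rewrite raddfB /= -[- w']scaleN1r -[- _%:M]scaleN1r.
  by rewrite -add_row_mx -scale_row_mx scaleN1r; exact: subgroupB.
have [d dP] := int_subgroup_principal hD.
have [|M' MP] := IH [set w | K (@row_mx _ 1 1 r 0 w)].
  split=> [|w w' Kw Kw']; first by rewrite /= row_mx0; exact: subgroup0.
  rewrite /= (_ : row_mx 0 (w - w') = row_mx 0 w - row_mx 0 w' :> 'rV_(1 + r)).
    exact: subgroupB.
  by rewrite opp_row_mx add_row_mx oppr0 addr0.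
have [w Kw] : D d by apply/dP.
exists (block_mx d%:M w 0 M' : 'M_(1 + r)) => v.
rewrite -[v](@hsubmxK _ 1 1 r) [lsubmx _]mx11_scalar.
move: (@lsubmx _ 1 1 r v 0 0) (@rsubmx _ 1 1 r v) => a b {v}; split=> [Kab|[u ->]].
- have /dP/dvdzP[q aE] : D a by exists b.
  have /MP[u uE] : K (@row_mx _ 1 1 r 0 (b - q *: w)).
    rewrite (_ : row_mx _ _ = row_mx a%:M b - row_mx d%:M w *~ q :> 'rV_(1 + r)).
      exact: subgroupB (subgroupMz hK q Kw).
    rewrite -scaler_int intz scale_row_mx opp_row_mx add_row_mx aE.
    by rewrite scale_scalar_mx subrr.
  exists (row_mx q%:M u); rewrite (mul_row_block q%:M u d%:M w 0 M').
  by rewrite mulmx0 addr0 -uE !mul_scalar_mx scale_scalar_mx -aE addrC subrK.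
- rewrite -[u](@hsubmxK _ 1 1 r) [lsubmx _]mx11_scalar.
  move: (@lsubmx _ 1 1 r u 0 0) (@rsubmx _ 1 1 r u) => q u'.
  rewrite (_ : _ *m _ = row_mx d%:M w *~ q + row_mx 0 (u' *m M') :> 'rV_(1 + r)).
    apply: subgroupD => //; first exact: subgroupMz.
    by apply/MP; exists u'.
  rewrite (mul_row_block q%:M u' d%:M w 0 M').
  rewrite -scaler_int intz scale_row_mx add_row_mx addr0 mulmx0 addr0.
  by rewrite !mul_scalar_mx.
Qed.

Lemma nth_sorted_dvdz (s : seq int) i j :
  sorted dvdz s -> (i <= j)%N -> (s`_i %| s`_j)%Z.
Proof.
move=> s_sorted le_ij.
have [j_lt|/(nth_default 0)->] := ltnP j (size s); last exact: dvdz0.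
apply: (sorted_leq_nth dvdz_trans dvdzz) => //; rewrite inE //.
exact: leq_ltn_trans j_lt.
Qed.

(** The relations among the entries of [s] modulo [A] form the row span of a matrix; its Smith
    normal form [P D R] gives new generators through the rows of [R], with orders on the
    diagonal. *)
Lemma finite_cyclic_decomposition (V : zmodType) (A : set V) (s : seq V) :
  additive_subgroup A ->
  exists (r : nat) (y : 'I_r -> V) (d : 'I_r -> int),
  [/\ forall i j : 'I_r, (i <= j)%N -> (d i %| d j)%Z,
      forall i, A (y i *~ d i),
      forall f : 'rV[int]_r,
        A (\sum_j y j *~ f 0 j) -> forall j, (d j %| f 0%R j)%Z
    & forall x, x \in s -> exists f : 'rV[int]_r, A (x - \sum_j y j *~ f 0 j)].
Proof.
move=> hA; pose r := size s.
pose comb (f : 'rV[int]_r) := \sum_(j < r) s`_j *~ f 0 j.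
have combD f g : comb (f + g) = comb f + comb g.
  by rewrite -big_split; apply: eq_bigr => j _; rewrite mxE mulrzDr.
have combN f : comb (- f) = - comb f.
  by rewrite -sumrN; apply: eq_bigr => j _; rewrite mxE mulrNz.
have [|M KM] := @row_subgroup_span r [set f | A (comb f)].
  split=> [|f g Kf Kg] /=; last by rewrite combD combN; exact: subgroupB.
  by rewrite /comb big1 => [|j _]; rewrite ?mxE //; exact: subgroup0.
have [P Pu [R Ru [d d_sorted ME]]] := int_Smith_normal_form M.
pose y (i : 'I_r) := comb (row i R).
have yE (f : 'rV[int]_r) : \sum_j y j *~ f 0 j = comb (f *m R).
  under eq_bigr => i _ do rewrite /y /comb mulrz_suml.
  rewrite exchange_big; apply: eq_bigr => j _; rewrite mxE mulrz_sumr.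
  by apply: eq_bigr => i _; rewrite mxE -mulrzA mulrC.
(* Past the end of [d] the default value 0 stands for infinite order, and it is divisible by
   everything. *)
exists r, y, (fun i => d`_i); split.
- by move=> i j; exact: nth_sorted_dvdz.
- move=> i; have -> : y i *~ d`_i = \sum_j y j *~ (d`_i *: delta_mx 0 i : 'rV_r) 0 j.
    rewrite (bigD1 i) //= !mxE !eqxx mulr1 big1 ?addr0 // => j /negPf ji.
    by rewrite !mxE eqxx ji mulr0.
  (* Row [i] of the inverse of [P], multiplied by [M], is the [i]-th diagonal entry times row [i] of
     [R]. *)
  rewrite yE; apply/KM; exists (delta_mx 0 i *m invmx P).
  rewrite ME !mulmxA mulmxKV //; congr (_ *m R).
  apply/rowP=> j; rewrite !mxE (bigD1 i) //= !mxE !eqxx mul1r big1 ?addr0.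
    by rewrite mulr_natr eq_sym.
  by move=> k /negPf ki; rewrite !mxE ki andbF mul0r.
- move=> f; rewrite yE => /KM[u]; rewrite ME !mulmxA; move: (u *m P) => {}u.
  move=> /(can_inj (mulmxK Ru)) -> j.
  rewrite mxE (bigD1 j) //= !mxE eqxx mulr1n big1 ?addr0.
    by apply: dvdz_mull; exact: dvdzz.
  by move=> k /negPf kj; rewrite !mxE [_ == _ :> nat]kj mulr0n mulr0.
- move=> x /(nthP 0)[k k_lt <-]; pose i := Ordinal k_lt.
  exists (delta_mx 0 i *m invmx R); rewrite yE mulmxKV //.
  rewrite /comb (bigD1 i) //= mxE !eqxx mulr1z big1 ?addr0 ?subrr.
    exact: subgroup0.
  by move=> j /negPf ji; rewrite mxE ji andbF.
Qed.

(** * Linear extension of traces to the free ring *)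

Lemma mulr_assoc4 (R : pzRingType) (a b c d : R) : a * (b * c) * d = a * b * (c * d).
Proof. by rewrite !mulrA. Qed.

Section LinearExtension.
Variable L : lieRingType.
Local Notation word m := (<< m >> : free_ring L).
Implicit Types (f : seq L -> L) (a b : free_ring L) (m p q : fmonom L).

Definition word_linear f a : L := \sum_(m <- msupp a) f (fmonom_val m) *~ a@_m.

Lemma word_linearEw f a (D : {fset fmonom L}) : (msupp a `<=` D)%fset ->
  word_linear f a = \sum_(m <- D) f (fmonom_val m) *~ a@_m.
Proof.
move=> aD; rewrite /word_linear (big_fset_incl _ aD) //= => m _.
by move/mcoeff_outdom ->; rewrite mulr0z.
Qed.

Lemma word_linear_zmod_morphism f : zmod_morphism (word_linear f).
Proof.
move=> a b; set D := (msupp a `|` msupp b)%fset.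
rewrite !(@word_linearEw f _ D) ?fsubsetUl ?fsubsetUr ?msuppB_le //.
by rewrite -sumrB; apply: eq_bigr => m _; rewrite mcoeffB mulrzBr.
Qed.

HB.instance Definition _ f :=
  GRing.isZmodMorphism.Build (free_ring L) L (word_linear f)
    (word_linear_zmod_morphism f).

Lemma word_linearU f m : word_linear f (word m) = f (fmonom_val m).
Proof. by rewrite (word_linearEw _ msuppU_le) big_seq_fset1 mcoeffUU mulr1z. Qed.

Lemma free_ringE a : a = \sum_(m <- msupp a) word m *~ a@_m.
Proof.
rewrite {1}[a]monalgE; apply: eq_bigr => m _.
by rewrite -(raddfMz (mkmalgU m)) intz.
Qed.

Lemma wordM p q : word p * word q = word (mmul p q).
Proof. by rewrite [LHS]fgmulUU mulr1. Qed.

Lemma word_linear3 f p x q :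
  word_linear f (word p * free_gen x * word q) = f (p ++ x :: q).
Proof. by rewrite !wordM word_linearU !fmM fmU -catA. Qed.

Lemma word_linear4 f p x y q :
  word_linear f (word p * (free_gen x * free_gen y) * word q)
  = f (p ++ x :: y :: q).
Proof. by rewrite !wordM word_linearU !fmM !fmU -catA. Qed.

Lemma zmod_morphism_words (h : free_ring L -> L) a : zmod_morphism h ->
  h a = \sum_(m <- msupp a) h (word m) *~ a@_m.
Proof.
move=> hB; pose hA := GRing.isZmodMorphism.Build _ _ h hB.
pose g : {additive free_ring L -> L} := HB.pack h hA.
rewrite -[h]/(g : _ -> _) {1}(free_ringE a) raddf_sum.
by apply: eq_bigr => m _; rewrite raddfMz.
Qed.

Lemma word_linearB f p a b q :
  word_linear f (word p * (a - b) * word q)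
  = word_linear f (word p * a * word q) - word_linear f (word p * b * word q).
Proof. by rewrite mulrBr mulrBl [LHS]raddfB. Qed.

Lemma word_linearD f p a b q :
  word_linear f (word p * (a + b) * word q)
  = word_linear f (word p * a * word q) + word_linear f (word p * b * word q).
Proof. by rewrite mulrDr mulrDl [LHS]raddfD. Qed.

Lemma word_linearMl f p a b q :
  word_linear f (word p * (a * b) * word q)
  = \sum_(m <- msupp a) word_linear f (word (mmul p m) * b * word q) *~ a@_m.
Proof.
pose h c := word_linear f (word p * (c * b) * word q).
have hB : zmod_morphism h by move=> x y; rewrite /h mulrBl mulrBr mulrBl [LHS]raddfB.
apply: etrans (zmod_morphism_words a hB) _.
by apply: eq_bigr => m _; rewrite /h -wordM (mulrA (word p)).
Qed.

Lemma word_linearMr f p a b q :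
  word_linear f (word p * (b * a) * word q)
  = \sum_(m <- msupp a) word_linear f (word p * b * word (mmul m q)) *~ a@_m.
Proof.
pose h c := word_linear f (word p * (b * c) * word q).
have hB : zmod_morphism h by move=> x y; rewrite /h mulrBr mulrBr mulrBl [LHS]raddfB.
apply: etrans (zmod_morphism_words a hB) _.
apply: eq_bigr => m _; rewrite /h.
apply: (congr1 (fun c => word_linear f c *~ a@_m)).
exact: etrans (mulr_assoc4 _ _ _ _) (congr1 (fun c => word p * b * c) (wordM m q)).
Qed.

Definition letters a : seq L := flatten (map (@fmonom_val L) (msupp a)).

Lemma letters_supp a m x : m \in msupp a -> x \in fmonom_val m -> x \in letters a.
Proof. by move=> am mx; apply/flattenP; exists (fmonom_val m) => //; apply: map_f. Qed.

(** The finite list [s] comes before [B] and [f], since a trace is only constructed once finitely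
    many letters are known. The contexts [p] and [q] make the condition stable under multiplication
    on both sides, with [s] enlarged by the letters of the multiplier. *)
Definition trace_null a : Prop := exists s : seq L,
  forall (B : set L) f, trace_on B f -> (forall x, x \in s -> B x) ->
  forall p q, (forall x, x \in (p ++ q : seq L) -> B x) ->
  word_linear f (word p * a * word q) = 0.

Lemma trace_null_word_linear a : trace_null a -> exists s : seq L,
  forall (B : set L) f, trace_on B f -> (forall x, x \in s -> B x) ->
  word_linear f a = 0.
Proof.
case=> s Hs; exists s => B f fB sB.
have := Hs B f fB sB mone mone; rewrite fm1 => /(_ (fun _ => notF \; False_ind _)) <-.
by apply: (congr1 (word_linear f)); rewrite -[word mone]/(1 : free_ring L) mul1r mulr1.
Qed.

Lemma trace_null_ideal : two_sided_ideal trace_null.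
Proof.
split; first split.
- by exists [::] => B f _ _ p q _; rewrite mulr0 mul0r raddf0.
- move=> a b [s Hs] [t Ht]; exists (s ++ t) => B f fB stB p q pqB.
  have sB x : x \in s -> B x by move=> xs; apply: stB; rewrite mem_cat xs.
  have tB x : x \in t -> B x by move=> xt; apply: stB; rewrite mem_cat xt orbT.
  apply: etrans (word_linearB f p a b q) _.
  apply: etrans (congr2 (fun u v => u - v) (Hs B f fB sB p q pqB)
                                           (Ht B f fB tB p q pqB)) _.
  exact: subrr.
move=> b a [s Hs]; split; exists (s ++ letters b) => B f fB sbB p q pqB.
- rewrite word_linearMl big_seq big1 // => m bm.
  rewrite (Hs B f fB) ?mul0rz // => x; rewrite ?fmM => hx.
    by apply: sbB; rewrite mem_cat hx.
  move: hx; rewrite -catA !mem_cat => /or3P[px|mx|qx].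
  + by apply: pqB; rewrite mem_cat px.
  + by apply: sbB; rewrite mem_cat (letters_supp bm mx) orbT.
  + by apply: pqB; rewrite mem_cat qx orbT.
- rewrite word_linearMr big_seq big1 // => m bm.
  rewrite (Hs B f fB) ?mul0rz // => x; rewrite ?fmM => hx.
    by apply: sbB; rewrite mem_cat hx.
  move: hx; rewrite !mem_cat => /or3P[px|mx|qx].
  + by apply: pqB; rewrite mem_cat px.
  + by apply: sbB; rewrite mem_cat (letters_supp bm mx) orbT.
  + by apply: pqB; rewrite mem_cat qx orbT.
Qed.

Lemma trace_null_envelope : ideal_gen (@envelope_rel L) `<=` trace_null.
Proof.
move=> a; apply; split; first exact: trace_null_ideal.
move=> _ [] [x] [y] ->; exists [:: x; y] => B f fB xyB p q pqB.
  apply: etrans (word_linearB _ _ _ _ _) _.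
  apply: etrans (congr2 (fun u v => u - v) (word_linear3 _ _ _ _)
    (word_linearD _ _ _ _ _)) _.
  apply: etrans (congr2 (fun u v => _ - (u + v)) (word_linear3 _ _ _ _)
    (word_linear3 _ _ _ _)) _.
  by rewrite (traceD fB) ?subrr //; apply: xyB; rewrite !inE eqxx ?orbT.
apply: etrans (word_linearB _ _ _ _ _) _.
apply: etrans (congr2 (fun u v => u - v) (word_linear3 _ _ _ _)
    (word_linearB _ _ _ _ _)) _.
apply: etrans (congr2 (fun u v => _ - (u - v)) (word_linear4 _ _ _ _ _)
    (word_linear4 _ _ _ _ _)) _.
by rewrite (trace_bracket fB) ?subrr //; apply: xyB; rewrite !inE eqxx ?orbT.
Qed.

(** * Powers of the augmentation ideal and word length *)

Definition words_ge k a : Prop :=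
  forall m, m \in msupp a -> (k <= size (fmonom_val m))%N.

Lemma words_ge_subgroup k : additive_subgroup (words_ge k).
Proof.
split=> [m|a b wa wb m /(fsubsetP (msuppB_le _ _))]; first by rewrite msupp0.
by rewrite in_fsetU => /orP[/wa|/wb].
Qed.

Lemma words_geM j k a b : words_ge j a -> words_ge k b -> words_ge (j + k) (a * b).
Proof.
move=> wa wb m /msuppM_le[m1 [m2 [/wa am1 /wb bm2 ->]]].
by rewrite fmM size_cat leq_add.
Qed.

Lemma aug_pow_words k : 
  ideal_pow (aug_ideal L) k `<=` @envelope_pi L @` words_ge k.
Proof.
have sub j : additive_subgroup (@envelope_pi L @` words_ge j).
  have hW := words_ge_subgroup j; split.
    by exists 0; [exact: (subgroup0 hW)|exact: raddf0].
  move=> _ _ [a wa <-] [b wb <-]; exists (a - b); first exact: (subgroupB hW).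
  exact: raddfB.
have aug1 : aug_ideal L `<=` @envelope_pi L @` words_ge 1.
  move=> u; apply; split; last first.
    move=> _ [x _ <-]; exists (free_gen x) => // m.
    by rewrite msuppU1 inE => /eqP->; rewrite fmU.
  split=> // c _ [a wa <-]; rewrite -(envelope_piK c); split.
    exists (repr c * a); last exact: rmorphM.
    (* The multiplier may contain the empty word, so it only counts as length at least 0. *)
    by apply: (@words_geM 0 1).
  exists (a * repr c); last exact: rmorphM.
  by apply: (@words_geM 1 0).
elim: k => [|[|k] IH] u.
- by move=> _; exists (repr u); [move=> m|exact: envelope_piK].
- exact: aug1.
- apply; split; first exact: sub.
  move=> _ [v [w [/aug1[a wa <-] /IH[b wb <-] ->]]].
  exists (a * b); first by rewrite -add1n; exact: words_geM.
  exact: rmorphM.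
Qed.

End LinearExtension.

(** * Existence of traces and conclusion *)

Lemma metabelian_trace_exists (L : lieRingType) (s : seq L) : metabelian L ->
  exists B f, @trace_on L B f /\ forall x, x \in s -> B x.
Proof.
move=> hL; have [r [y [d [d_chain d_y y_rel s_y]]]] :=
  finite_cyclic_decomposition s (derived_subgroup L).
exists (spanned y), (metabelian_trace y); split.
  exact: metabelian_trace_on d_y y_rel.
move=> x /s_y[f Ax]; exists (f, x); split=> //.
Qed.

Theorem theorem2p1 (L : lieRingType) (hL : metabelian L)
    (n : nat) (hn : (1 <= n)%N) :
  [set x *+ 2 | x in lie_dim L n] `<=` lcs L n.
Proof.
move=> _ [x /aug_pow_words[w w_ge /envelope_piP Iwx] <-].
have [s Hs] := trace_null_word_linear (trace_null_envelope Iwx).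
have [B [f [fB sB]]] := metabelian_trace_exists s hL.
(* The difference of [w] and the generator of [x] is a relation of the enveloping ring, so [f] takes
   the same value on both, namely [x *+ 2]. *)
have /eqP := Hs B f fB sB; rewrite raddfB subr_eq0 /= => /eqP.
rewrite [word_linear f (free_gen x)]word_linearU fmU (trace1 fB) => <-.
(* Computed on [w], this value is a combination of values of [f] on words of length at least [n]. *)
rewrite /word_linear big_seq; apply: (subgroup_sum (lcs_subgroup L n)) => m wm.
apply: (subgroupMz (lcs_subgroup L n)).
by apply: lcs_le (w_ge m wm) _ _; exact: trace_lcs fB _.
Qed.
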